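(* For every Cantor set $K\subset \mathbb{R}$, there exists a Cantor set $\widetilde{K}\subset \mathbb{R}$ with $|\widetilde{K}|>|K|$ such that $\left(\Delta^2_{y} (K\times \widetilde{K})\right)^\circ \neq \varnothing$ for some $y\in K\times \widetilde{K}$, where the interior is taken in $\mathbb{R}^2$.
   Context: A Cantor set is a subset of $\mathbb{R}^d$ that is compact, totally disconnected, and perfect. For a subset of $\mathbb{R}$, $|\cdot|$ denotes Lebesgue measure; for a vector, $|\cdot|$ denotes the Euclidean norm; $(\cdot)^\circ$ denotes the interior. For $X\subset\mathbb{R}^2$, $n\in\mathbb{N}$ and a pin $x\in X$, the pinned $n$-chain distance set is $$\Delta_x^n(X)=\{(|x^0-x^1|,|x^1-x^2|,\dots,|x^{n-1}-x^n|) : x^0=x,\ x^i\in X,\ x^i\neq x^j \text{ for } i\neq j\}\subset\mathbb{R}^n,$$ where $i,j$ range over $\{0,1,\dots,n\}$. Here $n=2$. *)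

(* Defs.v *)
From mathcomp Require Import all_boot all_order all_algebra.
From mathcomp Require Import all_classical all_reals all_analysis.

Set Implicit Arguments.
Unset Strict Implicit.
Unset Printing Implicit Defensive.

Import Order.TTheory GRing.Theory Num.Theory.
Import numFieldNormedType.Exports.

Local Open Scope classical_set_scope.
Local Open Scope ring_scope.

(* Nonemptiness is part of the usual convention for Cantor sets, and is needed
   here because [perfect_set set0] holds. *)
Definition cantor_set (T : topologicalType) (A : set T) : Prop :=
  [/\ A !=set0, compact A, totally_disconnected A & perfect_set A].

(* The library's norm on [R * R] is the max norm, hence this definition. *)
Definition eucl_dist (R : realType) (p q : R * R) : R :=
  Num.sqrt ((p.1 - q.1) ^+ 2 + (p.2 - q.2) ^+ 2).

(* For i : 'I_n, [widen_ord (leqnSn n) i] and [lift ord0 i] are the elements of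
   'I_n.+1 with values i and i.+1. *)
Definition pinned_chain_distances (R : realType) (n : nat)
    (X : set (R * R)) (x : R * R) : set 'rV[R]_n :=
  [set v | exists c : 'I_n.+1 -> R * R,
     [/\ c ord0 = x,
         forall i, X (c i),
         forall i j, i != j -> c i != c j &
         v = \row_i eucl_dist (c (widen_ord (leqnSn n) i)) (c (lift ord0 i))]].

(* Main.v *)
Require Import Defs.
From mathcomp Require Import all_boot all_order all_algebra.
From mathcomp Require Import all_classical all_reals all_analysis.
From mathcomp Require Import ring lra.
Import Order.TTheory GRing.Theory Num.Theory.
Import numFieldNormedType.Exports.
Local Open Scope classical_set_scope.
Local Open Scope ring_scope.

(** Why the theorem holds.  Let [K] lie in [[-r, r]] and let the radius [t]
    range over an interval above [2r].  For [k] in [K] the upper half of the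
    circle of radius [t] centred at [(k, u)] passes over every [l] in [K], at
    height [circle_height (k, u, t) l = u + sqrt (t^2 - (l - k)^2)].  Suppose
    that a Cantor set [C] meets the set of heights
    [E (k, u, t) = circle_height (k, u, t) @` K] for all [(k, u, t)] in a compact
    box, and that [0] is in [C].  Then, from the pin [(k0, 0)] and for any [s]
    and [t] in the interval, there is a point [(l1, u1)] of [K `*` C] at distance
    [s] from the pin, and then a point [(l2, u2)] of [K `*` C] at distance [t]
    from [(l1, u1)]; the three points differ because their heights increase.
    So the distance set contains an open square.  One family of circles serves
    both links, since the second one is again centred over a point of [K].

    It remains to find [C], large and meeting each [E p]
    ([cantor_set_meeting_family]).  It is [[0, M]] minus a dense sequence of open
    gaps with disjoint closures, chosen one by one so that every [E p] still
    meets the open set [V] that is left.  The reason why one more gap can be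
    removed ([robust_gap]): [E p] is perfect, so it meets [V] in two distinct
    points, and these persist for parameters near [p]; by compactness of the
    parameter set, some [d > 0] is such that every [E p] has two points of [V]
    more than [d] apart ([separated_hits]).  A gap shorter than [d] cannot
    contain both, wherever it is placed.  In the limit, compactness of [E p]
    gives a point that lies in no gap.  The gaps may be as short as desired, so
    [C] has measure at least [M - 1], and [M] is at our disposal. *)

(** * Cantor sets as complements of gaps *)

Definition gap_complement {R : realType} (M : R) (a b : nat -> R) : set R :=
  `[0, M] `\` \bigcup_n [set` `]a n, b n[].

Section GapComplement.
Variables (R : realType) (M : R) (a b : nat -> R).
Hypothesis gap_inside : forall n, [/\ 0 < a n, a n < b n & b n < M].
Hypothesis gaps_apart : forall m n, m != n -> b m < a n \/ b n < a m.
Hypothesis gaps_dense : forall x y, 0 <= x -> x < y -> y <= M ->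
  exists n, exists2 z, x < z < y & a n < z < b n.

Local Notation C := (gap_complement M a b).

Lemma gap_complementP x :
  C x <-> 0 <= x <= M /\ forall n, x <= a n \/ b n <= x.
Proof.
split.
  move=> [/=]; rewrite in_itv/= => xM nx; split=> // n.
  case: (leP x (a n)) => [|ax]; [by left|].
  case: (leP (b n) x) => [|xb]; [by right|].
  by exfalso; apply: nx; exists n => //=; rewrite in_itv/= ax xb.
move=> [xM gx]; split; first by rewrite /= in_itv.
move=> [n _ /=]; rewrite in_itv/= => /andP[ax xb].
by case: (gx n) => ?; lra.
Qed.

Lemma gap_endpoints_in n : C (a n) /\ C (b n).
Proof.
have [a0 ab bM] := gap_inside n.
split; apply/gap_complementP; (split; first by lra) => m;
  have [<-|/gaps_apart[]] := eqVneq n m; have [] := gap_inside m;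
  solve [left; lra | right; lra].
Qed.

(** Together with its mirror image below, this gives perfectness: a point strictly
    between [0] and [M] that is isolated on both sides would be an endpoint of
    two different gaps, whose closures are disjoint. *)
Lemma gap_complement_right x e : C x -> x < M -> 0 < e ->
  (exists2 y, C y & x < y < x + e) \/ exists n, x = a n.
Proof.
move=> /gap_complementP[xM gx] ltxM e0.
have [n [z]] : exists n, exists2 z, x < z < Num.min (x + e) M & a n < z < b n.
  apply: gaps_dense; first by lra.
    by rewrite lt_min; lra.
  by rewrite ge_min lexx orbT.
rewrite lt_min => /and3P[xz zxe zM] /andP[az zb].
case: (gx n) => [|?]; last lra.
rewrite le_eqVlt => /orP[/eqP ->|xa]; first by right; exists n.
by left; exists (a n); [have [] := gap_endpoints_in n|lra].
Qed.

Lemma gap_complement_left x e : C x -> 0 < x -> 0 < e ->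
  (exists2 y, C y & x - e < y < x) \/ exists n, x = b n.
Proof.
move=> /gap_complementP[xM gx] ltxM e0.
have [n [z]] : exists n, exists2 z, Num.max (x - e) 0 < z < x & a n < z < b n.
  apply: gaps_dense; last by lra.
    by rewrite le_max lexx orbT.
  by rewrite gt_max; lra.
rewrite gt_max => /andP[/andP[xz z0] zx] /andP[az zb].
case: (gx n) => [?|]; first lra.
rewrite le_eqVlt => /orP[/eqP <-|xa]; first by right; exists n.
by left; exists (b n); [have [] := gap_endpoints_in n|lra].
Qed.

Lemma gap_complement_compact : compact C.
Proof.
apply: (subclosed_compact _ (@segment_compact R 0 M)) => [|x []//].
apply: closedI; first exact: itv_closed.
by apply: open_closedC; apply: bigcup_open => n _; exact: itv_open.
Qed.

Lemma gap_complement_cantor : cantor_set C.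
Proof.
have [a0 ab bM] := gap_inside 0%N.
have C0 : C 0.
  apply/gap_complementP; split; first by lra.
  by move=> n; have [] := gap_inside n; left; lra.
split; first by exists 0.
- exact: gap_complement_compact.
- move=> x Cx; apply/seteqP; split=> [y [D [Dx DC Dc] Dy]|_ ->]; last first.
    by exists [set x] => //; split=> // [z -> //|]; exact: connected1.
  have itvD := (connected_intervalP D).1 Dc.
  suff noD u v : D u -> D v -> u < v -> False.
    by apply/eqP; rewrite eq_le !leNgt; apply/andP; split; apply/negP;
      exact: noD.
  move=> Du Dv uv.
  have /gap_complementP[uM _] := DC _ Du; have /gap_complementP[vM _] := DC _ Dv.
  have [n [z uzv azb]] : exists n, exists2 z, u < z < v & a n < z < b n.
    by apply: gaps_dense; lra.
  have /DC/gap_complementP[_ /(_ n)] : D z by apply: (itvD u v) => //; lra.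
  by case; lra.
- have clC : closed C.
    apply: compact_closed; [exact: norm_hausdorff|exact: gap_complement_compact].
  split=> //; apply/seteqP; split=> [x limx|x Cx U].
    by apply: clC => U /limx[y [_ Cy Uy]]; exists y.
  move=> /nbhs_ballP[e /= e0 xeU].
  have close y : C y -> x < y < x + e \/ x - e < y < x ->
      exists z, [/\ z != x, C z & U z].
    move=> Cy xey; exists y; split=> //; first by apply/eqP => yx; lra.
    by apply: xeU; rewrite /ball/= ltr_distl; lra.
  have /gap_complementP[xM gx] := Cx.
  (* Approach [x] from the right if possible; otherwise [x] is [M] or the left
     endpoint of a gap, and it can be approached from the left. *)
  have [ltxM|?] := ltP x M; last first.
    have [||[y Cy xy]|[n xb]] := gap_complement_left x e Cx; try lra.
      by apply: (close y) => //; right.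
    by have [] := gap_inside n; lra.
  have [[y Cy xy]|[n xa]] := gap_complement_right _ _ Cx ltxM e0.
    by apply: (close y) => //; left.
  have [? anbn _] := gap_inside n.
  have [||[y Cy xy]|[m xb]] := gap_complement_left x e Cx; try lra.
    by apply: (close y) => //; right.
  have [nm|/gaps_apart] := eqVneq n m; last by case; have [] := gap_inside m; lra.
  by move: anbn; rewrite -xa nm -xb ltxx.
Qed.
End GapComplement.

(** The error [1] is the sum of the allowed lengths [1 / 2 ^ n.+1]. *)
Lemma gap_complement_measure (R : realType) (M : R) (a b : nat -> R) :
  0 <= M -> (forall n, a n < b n) -> (forall n, b n - a n <= 1 / (2 ^ n.+1)%:R) ->
  (M%:E <= lebesgue_measure (gap_complement M a b) + 1)%E.
Proof.
move=> M0 ab len.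
pose G n : set R := [set` `]a n, b n[].
have mG n : measurable (G n) by exact: measurable_itv.
have mI : measurable [set` `[0%R, M]] by exact: measurable_itv.
have mUG : measurable (\bigcup_n G n) by exact: bigcupT_measurable.
have mC : measurable (gap_complement M a b).
  by apply: measurableD => //; exact: measurable_itv.
have -> : M%:E = lebesgue_measure [set` `[0%R, M]].
  rewrite lebesgue_measure_itv/= lte_fin; case: ltP => [_|?].
    by rewrite sube0.
  by congr EFin; lra.
have sub : (lebesgue_measure [set` `[0%R, M]] <=
    lebesgue_measure (gap_complement M a b `|` \bigcup_n G n))%E.
  apply: le_measure; rewrite ?inE; [exact: mI|exact: measurableU|].
  by move=> x xM; have [?|?] := pselect ((\bigcup_n G n) x); [right|left].
apply: (le_trans sub).
apply: (@le_trans _ _ (lebesgue_measure (gap_complement M a b) +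
                       lebesgue_measure (\bigcup_n G n))%E).
  exact: measureU2.
rewrite leeD2l//.
have subG := @measure_sigma_subadditive _ _ _ (@lebesgue_measure R) _ G
  mG mUG (fun=> id).
apply: (le_trans subG).
apply: le_trans (epsilon_trick0 xpredT ler01).
apply: lee_nneseries => n _ //=.
by rewrite /G lebesgue_measure_itv/= lte_fin ab -EFinB lee_fin.
Qed.

(** * Removing one gap *)

Section RemoveGap.
Variables (R : realType) (T : topologicalType) (A : set T) (E : T -> set R).
Hypothesis cA : compact A.
(* Lower semicontinuity of the set-valued map [E]. *)
Hypothesis E_lsc : forall p W, A p -> open W -> E p `&` W !=set0 ->
  \forall q \near p, E q `&` W !=set0.
Hypothesis E_perfect : forall p, A p -> E p `<=` limit_point (E p).

(** Two distinct points of [E p `&` V], which exist as [E p] has no isolated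
    point, can be followed by lower semicontinuity to parameters near [p] while
    keeping a definite distance; compactness of [A] makes this distance
    uniform. *)
Lemma separated_hits (V : set R) :
  open V -> (forall p, A p -> E p `&` V !=set0) ->
  exists2 d, 0 < d & forall p, A p -> exists x y,
    [/\ (E p `&` V) x, (E p `&` V) y & d < y - x].
Proof.
move=> oV hit.
pose P (d : R) (p : T) := exists x y,
  [/\ (E p `&` V) x, (E p `&` V) y & d < y - x].
have : \forall d \near (0 : R)^'+, A `<=` P d.
  apply: (compact_near_coveringP A).1 => // p Ap.
  have [x [Ex Vx]] := hit p Ap.
  have [y [yx Ey Vy]] := E_perfect p Ap x Ex V (open_nbhs_nbhs (conj oV Vx)).
  wlog xy : x y {yx} Ex Vx Ey Vy / x < y.
    by move=> H; case/lt_total/orP: yx => ?; [exact: (H y x)|exact: (H x y)].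
  (* Moving [x] and [y] by less than [e] leaves them more than [4 * e] apart. *)
  pose e := (y - x) / 6.
  have near_meets z : E p z -> V z ->
      \forall q \near p, E q `&` (V `&` [set` `]z - e, z + e[]) !=set0.
    move=> Ez Vz; apply: E_lsc => //; first by apply: openI => //; exact: itv_open.
    exists z; split=> //; split=> //=; rewrite in_itv/=; rewrite /e; lra.
  exists ([set q | E q `&` (V `&` [set` `]x - e, x + e[]) !=set0 /\
                   E q `&` (V `&` [set` `]y - e, y + e[]) !=set0],
          [set d | d < e]).
    split=> /=; last by apply: nbhs_right_lt; rewrite /e; lra.
    by apply: filterI; exact: near_meets.
  move=> [q d] /= [[[x' [Ex' [Vx' xx']]] [y' [Ey' [Vy' yy']]]] de].
  exists x', y'; split=> //.
  by move: xx' yy' de; rewrite /= !in_itv /e /=; lra.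
move=> H; near (0 : R)^'+ => d.
exists d; first by near: d; exact: nbhs_right_gt.
by near: d.
Unshelve. all: by end_near.
Qed.

(** An interval shorter than the distance of [separated_hits] misses one of the
    two points, so it can be removed from [V] at any place. *)
Lemma robust_gap (V U : set R) (eps : R) :
  open V -> (forall p, A p -> E p `&` V !=set0) ->
  open U -> U !=set0 -> 0 < eps -> exists ab : R * R,
   [/\ ab.1 < ab.2, ab.2 - ab.1 <= eps, [set` `[ab.1, ab.2]] `<=` U &
       forall p, A p -> E p `&` (V `\` [set` `[ab.1, ab.2]]) !=set0].
Proof.
move=> oV hit oU [c Uc] eps0.
have [d d0 sep] := separated_hits V oV hit.
have /nbhs_ballP[e /= e0 ceU] : nbhs c U by exact: open_nbhs_nbhs.
pose h := Num.min (Num.min d eps) e / 3.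
have h0 : 0 < h by rewrite divr_gt0// !lt_min d0 eps0.
have hd : 3 * h <= d by rewrite /h mulrC divfK// !ge_min lexx.
have he : 3 * h <= eps by rewrite /h mulrC divfK// !ge_min lexx orbT.
have hU : 3 * h <= e by rewrite /h mulrC divfK// !ge_min lexx !orbT.
exists (c - h, c + h); split=> /=; [lra|lra| |].
  move=> z /=; rewrite in_itv/= => zc; apply: ceU.
  by rewrite /ball/= ltr_distlC; lra.
move=> p /sep[x [y [[Ex Vx] [Ey Vy] dxy]]].
have [xc|xc] := boolP (x \in `[c - h, c + h]); last first.
  by exists x; split=> //; split=> //; exact/negP.
exists y; split=> //; split=> //; move: xc; rewrite /= !in_itv/=; lra.
Qed.
End RemoveGap.

(** * A Cantor set meeting a family of perfect sets *)

Definition rat_interval {R : realType} (n : nat) : set R :=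
  if unpickle n is Some pq then [set` `](ratr (pq : rat * rat).1), ratr pq.2[]
  else setT.

(** Where the next gap may be put: in [B] as soon as [V] meets [B], so that the
    gaps become dense when [B] runs through a base, and anywhere in [V]
    otherwise, so that there is a gap at every step. *)
Definition shrink {R : realType} (V B : set R) : set R :=
  if `[< V `&` B !=set0 >] then V `&` B else V.

Lemma open_rat_interval (R : realType) n : open (@rat_interval R n).
Proof.
by rewrite /rat_interval; case: unpickle => [pq|]; [exact: itv_open|exact: openT].
Qed.

Lemma shrink_sub (R : realType) (V B : set R) : shrink V B `<=` V.
Proof. by rewrite /shrink; case: asboolP => _ x; [case|]. Qed.

Lemma shrink_nonempty (R : realType) (V B : set R) :
  V !=set0 -> shrink V B !=set0.
Proof. by rewrite /shrink; case: asboolP. Qed.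

Lemma open_shrink (R : realType) (V B : set R) : open V -> open B ->
  open (shrink V B).
Proof. by rewrite /shrink; case: asboolP => // _ oV oB; exact: openI. Qed.

(** What is left after [n] gaps, when [g V n] gives the endpoints of the gap
    removed at step [n] from [V].  The closed gaps are removed: the stages are
    then open, and later gaps stay away from the endpoints of earlier ones. *)
Fixpoint stage {R : realType} (V0 : set R) (g : set R -> nat -> R * R) (n : nat)
    : set R :=
  if n is m.+1 then
    let V := stage V0 g m in V `\` [set` `[(g V m).1, (g V m).2]]
  else V0.

Lemma stage_sub (R : realType) (V0 : set R) g m n :
  (m <= n)%N -> stage V0 g n `<=` stage V0 g m.
Proof.
elim: n => [|n IH]; first by rewrite leqn0 => /eqP ->.
by rewrite leq_eqVlt => /predU1P[-> //|/IH mn] x [/mn].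
Qed.

Lemma stage_or_gap (R : realType) (V0 : set R) g n x : V0 x -> stage V0 g n x \/
  exists m, x \in `[(g (stage V0 g m) m).1, (g (stage V0 g m) m).2].
Proof.
move=> V0x; elim: n => [|n [Vx|]]; [by left| |by right].
have [xg|xg] := boolP (x \in `[(g (stage V0 g n) n).1, (g (stage V0 g n) n).2]).
  by right; exists n.
by left; split=> //; exact/negP.
Qed.

Section Meeting.
Variables (R : realType) (T : topologicalType) (A : set T) (E : T -> set R).
Hypothesis cA : compact A.
Hypothesis A0 : A !=set0.
Hypothesis E_lsc : forall p W, A p -> open W -> E p `&` W !=set0 ->
  \forall q \near p, E q `&` W !=set0.
Hypothesis E_perfect : forall p, A p -> E p `<=` limit_point (E p).
Hypothesis E_compact : forall p, A p -> compact (E p).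
Hypothesis E_nonempty : forall p, A p -> E p !=set0.

(** The gaps come from iterating [robust_gap], the [n]-th one inside the [n]-th
    rational interval whenever possible.  For each [p], a cluster point of
    points of [E p] taken in the successive stages avoids all the gaps, because
    a neighbourhood of it inside a gap would contain points of later stages. *)
Lemma cantor_set_meeting_family (M : R) :
  (forall p, A p -> E p `<=` [set` `]0, M[]) ->
  exists C : set R, [/\ cantor_set C, C 0,
    (M%:E <= lebesgue_measure C + 1)%E &
    forall p, A p -> E p `&` C !=set0].
Proof.
move=> EM.
pose hits (V : set R) := forall p, A p -> E p `&` V !=set0.
have nonempty V : hits V -> V !=set0.
  by move=> hV; have [p /hV[x [_ Vx]]] := A0; exists x.
have /choice[g0 g0P] : forall Vn : set R * nat, exists ab : R * R,
    open Vn.1 -> hits Vn.1 ->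
    [/\ ab.1 < ab.2, ab.2 - ab.1 <= 1 / (2 ^ Vn.2.+1)%:R,
        [set` `[ab.1, ab.2]] `<=` shrink Vn.1 (rat_interval Vn.2) &
        hits (Vn.1 `\` [set` `[ab.1, ab.2]])].
  move=> [V n] /=; have [[oV hV]|nV] := pselect (open V /\ hits V); last first.
    by exists (0, 0) => oV hV; case: nV.
  have [|||ab abP] := @robust_gap R T A E cA E_lsc E_perfect V
    (shrink V (rat_interval n)) (1 / (2 ^ n.+1)%:R) oV hV.
  - by apply: open_shrink => //; exact: open_rat_interval.
  - exact/shrink_nonempty/nonempty.
  - by rewrite divr_gt0// ltr0n expn_gt0.
  by exists ab.
pose g V n := g0 (V, n).
pose V := stage [set` `]0, M[] g.
pose a n := (g (V n) n).1; pose b n := (g (V n) n).2.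
have inv n : open (V n) /\ hits (V n).
  elim: n => [|n [oV hV]].
    split; first exact: itv_open.
    move=> p Ap; have [x Ex] := E_nonempty p Ap.
    by exists x; split=> //; exact: (EM p).
  have [_ _ _ hV'] := g0P (V n, n) oV hV.
  split; last exact: hV'.
  by apply: openI => //; apply: closed_openC; exact: itv_closed.
have gP n : [/\ a n < b n, b n - a n <= 1 / (2 ^ n.+1)%:R &
    [set` `[a n, b n]] `<=` shrink (V n) (rat_interval n)].
  by have [oV hV] := inv n; have [] := g0P (V n, n) oV hV.
have gapV n x : a n <= x <= b n -> V n x.
  move=> xab; have [_ _ sub] := gP n.
  by apply: shrink_sub; apply: (sub x); rewrite /= in_itv.
have gapM n x : a n <= x <= b n -> 0 < x < M.
  by move=> /gapV /(@stage_sub _ _ _ 0 n (leq0n n)); rewrite /= in_itv.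
have VN m n x : (m < n)%N -> V n x -> ~ (a m <= x <= b m).
  by move=> mn /(@stage_sub _ _ _ m.+1 n mn)[_ /=]; rewrite in_itv/= => /[swap] ->.
have ab n : a n < b n by have [] := gP n.
have stageV n x : 0 < x < M -> V n x \/ exists m, a m <= x <= b m.
  move=> xM; have [|Vx|[m]] := stage_or_gap _ [set` `]0, M[] g n x.
  - by rewrite /= in_itv.
  - by left.
  - by rewrite in_itv/=; right; exists m.
clearbody V.
have inside n : [/\ 0 < a n, a n < b n & b n < M].
  have := ab n; have := gapM n (a n); have := gapM n (b n).
  rewrite !lexx/= => gb ga abn.
  by split=> //; [have := ga (ltW abn)|have := gb _]; lra.
have apart m n : m != n -> b m < a n \/ b n < a m.
  wlog mn : m n / (m < n)%N.
    move=> H; case: ltngtP => // mn _; [|apply/or_comm];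
      by apply: H; rewrite // ltn_eqF.
  move=> _; case: (ltP (b m) (a n)) => [|nm]; [by left|].
  case: (ltP (b n) (a m)) => [|mn']; [by right|].
  have [abm abn] := (ab m, ab n).
  exfalso; have [mn1|mn1] := leP (a m) (a n).
    by apply: (@VN m n (a n) mn); [apply: gapV|]; lra.
  by apply: (@VN m n (a m) mn); [apply: gapV|]; lra.
(* If the [n]-th gap is not between [p] and [q], then the interval [(p, q)]
   misses [V n]; hence earlier closed gaps cover its part in [(0, M)], and it
   meets the interior of each closed gap that it meets. *)
have dense x y : 0 <= x -> x < y -> y <= M ->
    exists n, exists2 z, x < z < y & a n < z < b n.
  move=> x0 xy yM.
  have [p] := rat_in_itvoo xy; rewrite in_itv/= => /andP[xp py].
  have [q] := rat_in_itvoo py; rewrite in_itv/= => /andP[pq qy].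
  pose n := pickle (p, q).
  have Bn : @rat_interval R n = [set` `](ratr p), ratr q[].
    by rewrite /rat_interval pickleK.
  have abn := ab n.
  have [VB|VB] := pselect (V n `&` rat_interval n !=set0).
    exists n, ((a n + b n) / 2); last by lra.
    have [_ _ /(_ ((a n + b n) / 2))] := gP n.
    rewrite /shrink asboolT// Bn /= in_itv/= => H.
    by have [|_] := H; [lra|rewrite in_itv/=; lra].
  have [z0 z0pq] : exists z0 : R, ratr p < z0 < ratr q.
    by exists ((ratr p + ratr q) / 2); lra.
  have [|Vz|[m mz]] := stageV n z0; first by lra.
    by case: VB; rewrite Bn; exists z0; apply: (conj Vz); rewrite /= in_itv.
  have abm := ab m.
  pose u := Num.max (ratr p) (a m); pose v := Num.min (ratr q) (b m).
  have uv : u < v by rewrite /u /v gt_max !lt_min; lra.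
  have [pu au] : ratr p <= u /\ a m <= u by rewrite /u !le_max !lexx orbT.
  have [vq vb] : v <= ratr q /\ v <= b m by rewrite /v !ge_min !lexx orbT.
  by exists m, ((u + v) / 2); lra.
exists (gap_complement M a b); split.
- exact: gap_complement_cantor.
- apply/gap_complementP; have [? ? ?] := inside 0%N.
  by split; [lra|move=> n; left; have [] := inside n; lra].
- apply: gap_complement_measure => //; first by have [] := inside 0%N; lra.
  by move=> n; have [] := gP n.
- move=> p Ap.
  have /choice[x_ x_P] : forall n, exists x, E p x /\ V n x.
    by move=> n; have [_ /(_ p Ap)[x]] := inv n; exists x.
  have xE : (x_ @ \oo) (E p) by exists 0%N => // n _; have [] := x_P n.
  have [z [Ez clz]] := E_compact p Ap (x_ @ \oo) _ xE.
  exists z; split=> //; apply/gap_complementP; split.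
    by have := EM p Ap z Ez; rewrite /= in_itv/=; lra.
  move=> n; case: (leP z (a n)) => [|az]; [by left|].
  case: (leP (b n) z) => [|zb]; [by right|]; exfalso.
  have [||y [[m /= nm ->]]] := clz [set y | exists2 m, (n < m)%N & y = x_ m]
    [set` `]a n, b n[].
  - by exists n.+1 => // m /= nm; exists m.
  - by apply: open_nbhs_nbhs; split; [exact: itv_open|rewrite /= in_itv/= az zb].
  rewrite in_itv/= => /andP[amz zbm].
  by apply: (@VN n m (x_ m) nm); [have [] := x_P m|rewrite !ltW].
Qed.
End Meeting.

(** * Half circles over the given Cantor set *)

(** For [p = (k, u, t)], the height at abscissa [l] of the upper half circle of
    centre [(k, u)] and radius [t]. *)
Definition circle_height {R : realType} (p : R * R * R) (l : R) : R :=
  p.1.2 + Num.sqrt (p.2 ^+ 2 - (l - p.1.1) ^+ 2).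

Lemma circle_height_continuousl (R : realType) (p : R * R * R) :
  continuous (circle_height p).
Proof.
move=> l; apply: cvgD; first exact: cvg_cst.
apply: (@continuous_comp _ _ _ (fun l => p.2 ^+ 2 - (l - p.1.1) ^+ 2) Num.sqrt);
  last exact: sqrt_continuous.
apply: cvgB; first exact: cvg_cst.
apply: (@continuous_comp _ _ _ (fun l : R => l - p.1.1) (fun x => x ^+ 2));
  last exact: exprn_continuous.
by apply: cvgB; [exact: cvg_id|exact: cvg_cst].
Qed.

Lemma circle_height_continuousp (R : realType) (l : R) :
  continuous (fun p => circle_height p l).
Proof.
move=> p.
have fst2 : {for p, continuous (fun p : R * R * R => p.1.1)}.
  by apply: (@continuous_comp _ _ _ fst fst); exact: cvg_fst.
have snd2 : {for p, continuous (fun p : R * R * R => p.1.2)}.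
  by apply: (@continuous_comp _ _ _ fst snd); [exact: cvg_fst|exact: cvg_snd].
apply: cvgD; first exact: snd2.
apply: (@continuous_comp _ _ _
  (fun p : R * R * R => p.2 ^+ 2 - (l - p.1.1) ^+ 2) Num.sqrt);
  last exact: sqrt_continuous.
apply: cvgB.
  apply: (@continuous_comp _ _ _ (fun p : R * R * R => p.2) (fun x => x ^+ 2));
    [exact: cvg_snd|exact: exprn_continuous].
apply: (@continuous_comp _ _ _ (fun p : R * R * R => l - p.1.1) (fun x => x ^+ 2));
  last exact: exprn_continuous.
by apply: cvgB; [exact: cvg_cst|exact: fst2].
Qed.

Lemma circle_height_eq (R : realType) (p : R * R * R) (l l' : R) :
  `|l - p.1.1| <= p.2 -> `|l' - p.1.1| <= p.2 ->
  circle_height p l = circle_height p l' -> l' = l \/ l' = 2 * p.1.1 - l.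
Proof.
have pos x : `|x - p.1.1| <= p.2 -> 0 <= p.2 ^+ 2 - (x - p.1.1) ^+ 2.
  by rewrite ler_norml => xp; nra.
move=> /pos posl /pos posl' /addrI/eqP; rewrite eqr_sqrt// => /eqP e.
have /eqP : (l' - l) * (l' - (2 * p.1.1 - l)) = 0 by lra.
by rewrite mulf_eq0 !subr_eq0 => /orP[]/eqP; [left|right].
Qed.

(** The height takes each value at most twice, at abscissas symmetric about the
    centre, so points of [K] close to [l] and other than [l] have heights other
    than that of [l]. *)
Lemma circle_height_limit_point (R : realType) (K : set R) (p : R * R * R) :
  K `<=` limit_point K -> (forall l, K l -> `|l - p.1.1| <= p.2) ->
  circle_height p @` K `<=` limit_point (circle_height p @` K).
Proof.
move=> Klim Kp _ [l Kl <-] U /(@circle_height_continuousl R p).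
rewrite nbhs_simpl /= => nU.
have nW : nbhs l [set x | l = p.1.1 \/ x != 2 * p.1.1 - l].
  have [->|lp] := eqVneq l p.1.1; first by near=> x; left.
  have : \forall x \near l, x != 2 * p.1.1 - l.
    have : nbhs l (~` [set 2 * p.1.1 - l]).
      apply: open_nbhs_nbhs; split; first by apply: closed_openC; exact: closed_eq.
      by move=> /= e; move/eqP: lp; apply; lra.
    by apply: filterS => x /eqP.
  by apply: filterS => x; right.
have [l' [ll' Kl' [/= Ul' Wl']]] := Klim l Kl _ (filterI nU nW).
exists (circle_height p l'); split=> //; last by exists l'.
apply/eqP => /circle_height_eq[|||]; [exact: Kp|exact: Kp| |].
  by move/esym/eqP; exact/negP.
move=> e; case: Wl' => [lp|/eqP]; last by apply; lra.
by move/eqP: ll'; apply; lra.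
Unshelve. all: by end_near.
Qed.

Lemma eucl_dist_circle_height (R : realType) (k u t l : R) : `|l - k| <= t ->
  eucl_dist (k, u) (l, circle_height (k, u, t) l) = t.
Proof.
move=> lkt; have t0 : 0 <= t by exact: le_trans lkt.
move: lkt; rewrite ler_norml /eucl_dist /circle_height/= => lkt.
have -> : u - (u + Num.sqrt (t ^+ 2 - (l - k) ^+ 2)) =
  - Num.sqrt (t ^+ 2 - (l - k) ^+ 2) by ring.
rewrite sqrrN sqr_sqrtr; last by nra.
have -> : (k - l) ^+ 2 + (t ^+ 2 - (l - k) ^+ 2) = t ^+ 2 by ring.
by rewrite sqrtr_sqr ger0_norm.
Qed.

Lemma circle_height_bounds (R : realType) (k u t l : R) : `|l - k| < t ->
  u < circle_height (k, u, t) l <= u + t.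
Proof.
move=> lkt; have t0 : 0 <= t by rewrite (le_trans _ (ltW lkt)).
move: lkt; rewrite ltr_norml /circle_height/= => lkt.
rewrite ltrDl sqrtr_gt0 lerD2l subr_sqr; apply/andP; split.
  by apply: mulr_gt0; lra.
by rewrite -[leRHS](ger0_norm t0) -sqrtr_sqr ler_wsqrtr// -subr_sqr gerBl sqr_ge0.
Qed.

(** Radii exceed [2 * r], so every circle centred over a point of [K] passes
    over all of [K].  Centres are allowed up to height [2 * r + 2], the largest
    radius, as the second circle is centred on a circle around the pin, which
    has height [0].  Heights then stay below [4 * r + 5], and the measure of the
    Cantor set exceeds [2 * r], hence that of [K]. *)
Lemma cantor_set_meeting_circles (R : realType) (K : set R) (r : R) :
  cantor_set K -> 0 <= r -> K `<=` [set` `[- r, r]] ->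
  let t0 := 2 * r + 1 in let t1 := 2 * r + 2 in
  exists C : set R, [/\ cantor_set C, C 0,
    ((4 * r + 4)%:E <= lebesgue_measure C)%E &
    forall k u t, K k -> 0 <= u <= t1 -> t0 <= t <= t1 ->
      exists2 l, K l & C (circle_height (k, u, t) l)].
Proof.
move=> [K0 cK _ [clK limK]] r0 Kr t0 t1.
have Kdist k l t : K k -> K l -> t0 <= t -> `|l - k| < t.
  move=> /Kr + /Kr; rewrite /= !in_itv/= /t0 ltr_norml; lra.
pose A : set (R * R * R) := K `*` [set` `[0, t1]] `*` [set` `[t0, t1]].
pose E (p : R * R * R) := circle_height p @` K.
have Kp p l : A p -> K l -> `|l - p.1.1| < p.2.
  by move=> [[/= Kk _]]; rewrite in_itv/= => /andP[tp _] Kl; exact: Kdist.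
have [||||||p Ap|C [cC C0 mC meet]] :=
  @cantor_set_meeting_family R (R * R * R)%type A E _ _ _ _ _ _ (4 * r + 5).
- by apply: compact_setX; [apply: compact_setX => //|]; exact: segment_compact.
- have [k Kk] := K0; exists (k, 0, t0); split; first split=> //=.
    by rewrite in_itv/= /t1; lra.
  by rewrite /= in_itv/= /t0 /t1; lra.
- move=> p W Ap oW [_ [[l Kl <-] Wl]].
  have : \forall q \near p, W (circle_height q l).
    by apply: (@circle_height_continuousp R l p); exact: open_nbhs_nbhs.
  by apply: filterS => q Wq; exists (circle_height q l); split=> //; exists l.
- move=> p Ap; apply: circle_height_limit_point; first by rewrite limK.
  by move=> l Kl; exact/ltW/Kp.
- move=> p Ap; apply: continuous_compact => //.
  by apply: continuous_subspaceT; exact: circle_height_continuousl.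
- by move=> p Ap; have [k Kk] := K0; exists (circle_height p k); exists k.
- move=> _ [l Kl <-]; have := Kp p l Ap Kl.
  case: p Ap => [[k u] t] [[/= _ +] +]; rewrite !in_itv/= => ut tt.
  move=> /(circle_height_bounds _ _ u).
  by move: ut tt; rewrite /t1; lra.
exists C; split=> //.
  rewrite (_ : 4 * r + 4 = (4 * r + 5) - 1); last by ring.
  by rewrite EFinB leeBlDr.
move=> k u t Kk ut tt.
have [|_ [[l Kl <-] Cl]] := meet (k, u, t); last by exists l.
by split=> //=; rewrite in_itv.
Qed.

(** * Two-link chains *)

Lemma interior_of_cube (R : realType) (n : nat) (c e : R) (S : set 'rV[R]_n) :
  0 < e -> (forall v : 'rV[R]_n, (forall i, `|v ord0 i - c| < e) -> S v) ->
  S° !=set0.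
Proof.
move=> e0 sub; exists (const_mx c); apply/nbhs_ballP; exists e => //= v [_ cv].
by apply: sub => i; have := cv ord0 i; rewrite mxE /ball/= distrC.
Qed.

Theorem theorem2p2 (R : realType) (K : set R) :
  cantor_set K ->
  exists K' : set R,
    [/\ cantor_set K',
        (lebesgue_measure K < lebesgue_measure K')%E &
        exists2 y : R * R, (K `*` K') y &
          (pinned_chain_distances (n := 2) (K `*` K') y)° !=set0].
Proof.
move=> cantorK; have [[k0 Kk0] cK _ _] := cantorK.
have [r r0 Kr] : exists2 r, 0 <= r & K `<=` [set` `[- r, r]].
  have [N [_ HN]] := compact_bounded cK.
  exists (Num.max N 0 + 1).
    by rewrite addr_ge0// le_max lexx orbT.
  move=> x Kx; rewrite /= in_itv/= -ler_norml; apply: HN => //.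
  by rewrite (@le_lt_trans _ _ (Num.max N 0)) ?le_max ?lexx// ltrDl.
have [C [cC C0 mC meet]] := cantor_set_meeting_circles _ _ _ cantorK r0 Kr.
have near_diam k l t : K k -> K l -> 2 * r + 1 <= t -> `|l - k| < t.
  by move=> /Kr + /Kr; rewrite /= !in_itv/= ltr_norml; lra.
exists C; split=> //.
  apply: (@le_lt_trans _ _ (2 * r)%:E); last first.
    by apply: lt_le_trans mC; rewrite lte_fin; lra.
  have -> : (2 * r)%:E = lebesgue_measure [set` `[- r, r]].
    rewrite lebesgue_measure_itv/= lte_fin; case: ltP => [_|?].
      by rewrite -EFinB; congr EFin; ring.
    by congr EFin; lra.
  apply: le_measure; rewrite ?inE //.
    exact: measurable_realfun.compact_measurable.
exists (k0, 0) => //.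
apply: (@interior_of_cube R 2 (2 * r + 3 / 2) (1 / 2)); first lra.
move=> v vP.
set s := v ord0 ord0; set t := v ord0 (lift ord0 ord0).
have [sP tP] : 2 * r + 1 < s < 2 * r + 2 /\ 2 * r + 1 < t < 2 * r + 2.
  by split; [have := vP ord0|have := vP (lift ord0 ord0)];
    rewrite ltr_distl -/s -/t; lra.
have [||l1 Kl1 Cl1] := meet k0 0 s Kk0; try lra.
set u1 := circle_height _ _ in Cl1.
have /andP[u1_gt0 u1s] : 0 < u1 <= 0 + s.
  by apply: circle_height_bounds; apply: near_diam => //; lra.
have [||l2 Kl2 Cl2] := meet l1 u1 t Kl1; try lra.
set u2 := circle_height _ _ in Cl2.
have /andP[u12 _] : u1 < u2 <= u1 + t.
  by apply: circle_height_bounds; apply: near_diam => //; lra.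
pose c (i : 'I_3) : R * R := nth (k0, 0) [:: (k0, 0); (l1, u1); (l2, u2)] i.
exists c; split=> //.
- by move=> [[|[|[|m]]] im].
- have c2_incr : {homo (fun i => (c i).2) : i j / (i < j)%N >-> i < j}.
    by move=> [[|[|[|m]]] im] [[|[|[|k]]] jm] //= _; lra.
  move=> i j; rewrite neq_ltn => /orP[] /c2_incr;
    by apply: contraTneq => ->; rewrite ltxx.
- apply/rowP => [[[|[|m]] // im]]; rewrite !mxE /c /=.
    rewrite eucl_dist_circle_height; [|apply: ltW; apply: near_diam => //; lra].
    by congr (v _ _); apply/val_inj.
  rewrite eucl_dist_circle_height; [|apply: ltW; apply: near_diam => //; lra].
  by congr (v _ _); apply/val_inj.
Qed.
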